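(* Let $\omega$ be a symplectic structure on a $2r$-dimensional real Lie algebra $\mathfrak{r}$, let $\mathfrak{h}$ be a finite-dimensional real Lie algebra with an NDB structure $\phi'=\phi'_S+\phi'_A$, and let $D\colon\mathfrak{h}\to\operatorname{Der}(\mathfrak{r},\omega)$ be a homomorphism of Lie algebras. Let $\mathfrak{g}=\mathfrak{h}\ltimes_D\mathfrak{r}$ be the semidirect sum, i.e. the vector space $\mathfrak{h}\oplus\mathfrak{r}$ with Lie bracket $$[x+a,y+b]=[x,y]'+[a,b]_{\mathfrak{r}}+D(x)b-D(y)a\qquad(x,y\in\mathfrak{h},\ a,b\in\mathfrak{r}),$$ where $[\cdot,\cdot]'$ and $[\cdot,\cdot]_{\mathfrak{r}}$ are the Lie brackets of $\mathfrak{h}$ and $\mathfrak{r}$. Then the bilinear form $\phi$ on $\mathfrak{g}$ defined by $$\phi(x+a,y+b)=\phi'(x,y)+\omega(a,b)\qquad(x,y\in\mathfrak{h},\ a,b\in\mathfrak{r})$$ is an NDB structure on $\mathfrak{g}$.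
   Context: A bilinear form $\phi$ on a finite-dimensional real vector space $V$ is non-degenerate if $V\to V^*$, $x\mapsto\phi(x,\cdot)$, is an isomorphism. Write $\phi=\phi_S+\phi_A$ with $\phi_S$ the symmetric part and $\phi_A$ the skew-symmetric part. An NDB structure on a Lie algebra $\mathfrak{g}$ is a non-degenerate bilinear form $\phi$ on $\mathfrak{g}$ such that $\phi_A([x,y],z)+\phi_A([y,z],x)+\phi_A([z,x],y)=\phi_S(x,[y,z])$ for all $x,y,z\in\mathfrak{g}$. A symplectic structure on a Lie algebra $\mathfrak{r}$ is a non-degenerate skew-symmetric bilinear form $\omega$ with $\omega([x,y],z)+\omega([y,z],x)+\omega([z,x],y)=0$ for all $x,y,z\in\mathfrak{r}$. The Lie algebra of symplectic derivations is $\operatorname{Der}(\mathfrak{r},\omega)=\{A\in\operatorname{Der}(\mathfrak{r})\mid\omega(A(x),y)+\omega(x,A(y))=0\text{ for all }x,y\in\mathfrak{r}\}$. *)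

(* Defs.v *)
From HB Require Import structures.
From mathcomp Require Import all_boot all_order all_algebra.
From mathcomp Require Import boolp.

Set Implicit Arguments.
Unset Strict Implicit.
Unset Printing Implicit Defensive.

Import GRing.Theory.
Local Open Scope ring_scope.

(* The carrier is a module of arbitrary dimension, so that a subalgebra of
   'End(V) can be a Lie algebra without exhibiting a basis of it. *)
HB.mixin Record Lmodule_isLieAlgebra (R : fieldType) L & GRing.Lmodule R L := {
  lie : L -> L -> L;
  lie_bilinear_subproof : bilinear_for *:%R *:%R lie;
  liexx : forall x, lie x x = 0;
  lie_jacobi : forall x y z,
    lie x (lie y z) + lie y (lie z x) + lie z (lie x y) = 0
}.

#[short(type="lieAlgType")]
HB.structure Definition LieAlgebra (R : fieldType) :=
  {L of GRing.Lmodule R L & Lmodule_isLieAlgebra R L}.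

#[short(type="finDimLieAlgType")]
HB.structure Definition FinDimLieAlgebra (R : fieldType) :=
  {L of Vector R L & Lmodule_isLieAlgebra R L}.

HB.instance Definition _ (R : fieldType) (L : lieAlgType R) :=
  bilinear_isBilinear.Build R L L L *:%R *:%R (@lie R L)
    (@lie_bilinear_subproof R L).

HB.mixin Record isLieMorphism (R : fieldType) (L M : lieAlgType R)
    (f : L -> M) := {
  lie_morphism_subproof : {morph f : x y / lie x y >-> lie x y}
}.

#[short(type="lieMorphism")]
HB.structure Definition LieMorphism (R : fieldType) (L M : lieAlgType R) :=
  {f of isLieMorphism R L M f & @GRing.Linear R L M *:%R f}.

Notation "{ 'lie' L -> M }" := (@LieMorphism.type _ L%type M%type)
  (at level 0, L at level 98, M at level 99,
   format "{ 'lie'  L  ->  M }") : type_scope.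

Section LieTheory.
Variables (R : fieldType) (L M : lieAlgType R).
Implicit Types x y z : L.

Lemma lieDl x y z : lie (x + y) z = lie x z + lie y z.
Proof. exact: linearDl. Qed.
Lemma lieDr x y z : lie x (y + z) = lie x y + lie x z.
Proof. exact: linearDr. Qed.
Lemma lieNl x y : lie (- x) y = - lie x y.
Proof. exact: linearNl. Qed.
Lemma lieNr x y : lie x (- y) = - lie x y.
Proof. exact: linearNr. Qed.
Lemma lieZl a x y : lie (a *: x) y = a *: lie x y.
Proof. exact: linearZl_LR. Qed.
Lemma lieZr a x y : lie x (a *: y) = a *: lie x y.
Proof. exact: linearZr_LR. Qed.
Lemma lie0l x : lie 0 x = 0.
Proof. exact: linear0l. Qed.
Lemma lie0r x : lie x 0 = 0.
Proof. exact: linear0r. Qed.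

Lemma lieC x y : lie x y = - lie y x.
Proof.
apply/eqP; rewrite -addr_eq0; apply/eqP.
by have := liexx (x + y); rewrite lieDl !lieDr !liexx add0r addr0.
Qed.

Lemma lie_morph (f : {lie L -> M}) : {morph f : x y / lie x y >-> lie x y}.
Proof. exact: lie_morphism_subproof. Qed.

End LieTheory.

Section Forms.
Variables (R : fieldType) (V : vectType R) (phi : {biscalar V}).

(* V -> V^*, x |-> phi(x, .), where V^* is 'Hom(V, R^o) *)
Definition flat (x : V) : 'Hom(V, R^o) := linfun (phi x : V -> R^o).

Lemma flatE x y : flat x y = phi x y.
Proof. by rewrite /flat (lfunE (phi x : {linear V -> R^o})). Qed.

Lemma flat_is_linear : linear flat.
Proof.
move=> a x y; apply/lfunP => z.
by rewrite add_lfunE scale_lfunE !flatE linearPl.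
Qed.

HB.instance Definition _ := GRing.isLinear.Build R V 'Hom(V, R^o) _ flat
  flat_is_linear.

Definition nondegenerate_form : Prop := bijective flat.

Definition sym_part (x y : V) : R := (phi x y + phi y x) / 2.
Definition skew_part (x y : V) : R := (phi x y - phi y x) / 2.

End Forms.

Definition ndb_structure (R : fieldType) (L : finDimLieAlgType R)
    (phi : {biscalar L}) : Prop :=
  nondegenerate_form phi /\
  forall x y z : L,
    skew_part phi (lie x y) z + skew_part phi (lie y z) x
      + skew_part phi (lie z x) y
    = sym_part phi x (lie y z).

Definition symplectic_structure (R : fieldType) (L : finDimLieAlgType R)
    (omega : {biscalar L}) : Prop :=
  [/\ nondegenerate_form omega,
      forall x y : L, omega x y = - omega y x &
      forall x y z : L,
        omega (lie x y) z + omega (lie y z) x + omega (lie z x) y = 0].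

Section SymplecticDerivations.
Variables (R : fieldType) (L : finDimLieAlgType R) (omega : {biscalar L}).

Definition derivation (A : 'End(L)) : Prop :=
  forall x y, A (lie x y) = lie (A x) y + lie x (A y).

Definition symp_derivation : {pred 'End(L)} := [pred A |
  `[< derivation A /\ forall x y, omega (A x) y + omega x (A y) = 0 >]].

Lemma symp_derivationP (A : 'End(L)) :
  reflect (derivation A /\ forall x y, omega (A x) y + omega x (A y) = 0)
          (A \in symp_derivation).
Proof. exact: asboolP. Qed.

Lemma symp_derivation_submod_closed : submod_closed symp_derivation.
Proof.
split=> [|a A B /symp_derivationP[dA oA] /symp_derivationP[dB oB]].
  apply/symp_derivationP; split=> x y; rewrite !zero_lfunE.
    by rewrite lie0l lie0r addr0.
  by rewrite linear0l linear0r addr0.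
apply/symp_derivationP; split=> x y; rewrite !(add_lfunE, scale_lfunE).
  by rewrite dA dB !(lieDl, lieDr, lieZl, lieZr) scalerDr addrACA.
by rewrite linearPl linearPr addrACA -mulrDr oA oB mulr0 addr0.
Qed.

HB.instance Definition _ := GRing.isSubmodClosed.Build R 'End(L)
  symp_derivation symp_derivation_submod_closed.

Record symp_der := SympDer {
  symp_der_val :> 'End(L);
  symp_der_valP : symp_der_val \in symp_derivation
}.

HB.instance Definition _ := [isSub for symp_der_val].
HB.instance Definition _ := [Choice of symp_der by <:].
HB.instance Definition _ := [SubChoice_isSubLmodule of symp_der by <:].

Lemma symp_der_lie_subproof (A B : symp_der) :
  ((A \o B) - (B \o A))%VF \in symp_derivation.
Proof.
case: A B => [A /symp_derivationP[dA oA]] [B /symp_derivationP[dB oB]] /=.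
apply/symp_derivationP; split=> x y; rewrite !(add_lfunE, opp_lfunE, comp_lfunE).
  rewrite dA dB !raddfD /= !dA !dB !(lieDl, lieDr, lieNl, lieNr) !opprD.
  rewrite [LHS](AC ((2*2)*(2*2)) ((1*5)*(4*8)*((2*7)*(3*6)))) /=.
  by rewrite !subrr !addr0.
rewrite linearDl linearDr linearNl linearNr /=.
have o (C : 'End(L)) : (forall x y, omega (C x) y + omega x (C y) = 0) ->
    forall x y, omega (C x) y = - omega x (C y).
  by move=> oC u v; apply/eqP; rewrite -addr_eq0 oC.
rewrite (o A oA) (o B oB (A x)) (o A oA x) (o B oB x) !opprK.
by rewrite (AC (2*2) ((1*4)*(2*3))) /= addNr subrr addr0.
Qed.

Definition symp_der_lie (A B : symp_der) : symp_der :=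
  SympDer (symp_der_lie_subproof A B).

Lemma symp_der_lieE (A B : symp_der) x :
  symp_der_lie A B x = A (B x) - B (A x).
Proof. by rewrite /= add_lfunE opp_lfunE !comp_lfunE. Qed.

Lemma symp_der_addE (A B : symp_der) x : (A + B) x = A x + B x.
Proof. by rewrite -add_lfunE -[symp_der_val]/val raddfD. Qed.

Lemma symp_der_scaleE a (A : symp_der) x : (a *: A) x = a *: A x.
Proof. by rewrite -scale_lfunE -[symp_der_val]/val linearZ. Qed.

Lemma symp_der_eqP (A B : symp_der) : (forall x, A x = B x) -> A = B.
Proof. by move=> eqAB; apply/val_inj/lfunP. Qed.

Lemma symp_der_lie_bilinear : bilinear_for *:%R *:%R symp_der_lie.
Proof.
split=> C a A B; apply: symp_der_eqP => x;
  rewrite !(symp_der_lieE, symp_der_addE, symp_der_scaleE);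
  by rewrite linearP scalerBr ?opprD addrACA.
Qed.

Lemma symp_der_liexx A : symp_der_lie A A = 0.
Proof. by apply/val_inj; rewrite /= subrr. Qed.

Lemma symp_der_lie_jacobi A B C :
  symp_der_lie A (symp_der_lie B C) + symp_der_lie B (symp_der_lie C A)
    + symp_der_lie C (symp_der_lie A B) = 0.
Proof.
apply: symp_der_eqP => x; rewrite !(symp_der_addE, symp_der_lieE).
rewrite !raddfB /= zero_lfunE.
rewrite !opprK (AC ((2*2)*(2*2)*(2*2))
  ((1*11)*(8*2)*(5*3)*(4*10)*(12*6)*(9*7))) /=.
by rewrite !addrN !addr0.
Qed.

HB.instance Definition _ := Lmodule_isLieAlgebra.Build R symp_der
  symp_der_lie_bilinear symp_der_liexx symp_der_lie_jacobi.

End SymplecticDerivations.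

Section Semidirect.
Variables (R : fieldType) (h r : finDimLieAlgType R) (omega : {biscalar r}).

(* h |x_D r: a Lie bracket depending on D is put on the vector space h (+) r,
   hence the otherwise unused argument. *)
Definition semidirect of {lie h -> symp_der omega} : Type := (h * r)%type.

Variable D : {lie h -> symp_der omega}.

HB.instance Definition _ := Vector.copy (semidirect D) (h * r)%type.

Lemma lie_symp_derP a (x y : h) b : D (a *: x + y) b = a *: D x b + D y b.
Proof.
rewrite linearP; etransitivity; first exact: symp_der_addE.
by congr (_ + _); exact: symp_der_scaleE.
Qed.

Lemma lie_symp_der_lie (x y : h) b :
  D (lie x y) b = D x (D y b) - D y (D x b).
Proof. by rewrite lie_morph; exact: symp_der_lieE. Qed.

Lemma symp_der_derivation (A : symp_der omega) : derivation A.
Proof. by case/symp_derivationP: (symp_der_valP A). Qed.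

Definition semidirect_lie (u v : semidirect D) : semidirect D :=
  (lie u.1 v.1, lie u.2 v.2 + D u.1 v.2 - D v.1 u.2).

Lemma semidirect_lie_bilinear : bilinear_for *:%R *:%R semidirect_lie.
Proof.
split=> w a u v; congr pair => /=.
- by rewrite lieDl lieZl.
- rewrite lie_symp_derP linearP lieDl lieZl.
  rewrite scalerBr scalerDr opprD.
  by rewrite (AC (2*2*2) ((1*3*5)*(2*4*6))).
- by rewrite lieDr lieZr.
- rewrite lie_symp_derP linearP lieDr lieZr.
  rewrite scalerBr scalerDr opprD.
  by rewrite (AC (2*2*2) ((1*3*5)*(2*4*6))).
Qed.

Lemma semidirect_liexx u : semidirect_lie u u = 0.
Proof. by congr pair; rewrite /= ?addrK liexx. Qed.

Lemma semidirect_lie_jacobi u v w :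
  semidirect_lie u (semidirect_lie v w) + semidirect_lie v (semidirect_lie w u)
    + semidirect_lie w (semidirect_lie u v) = 0.
Proof.
congr pair; rewrite /= ?lie_jacobi //.
rewrite !lie_symp_der_lie !raddfB !raddfD /= !symp_der_derivation.
rewrite !lieDr !lieNr.
rewrite (lieC (D u.1 v.2)) (lieC (D v.1 w.2)) (lieC (D w.1 u.2)) !opprK.
rewrite (AC ((3*4*2)*(3*4*2)*(3*4*2))
  ((1*10*19)*(2*13)*(20*4)*(11*22)*(23*3)*(5*12)*(14*21)*(6*26)*(18*7)
   *(15*8)*(9*25)*(24*17)*(27*16))) /=.
by rewrite lie_jacobi !addrN !addr0.
Qed.

HB.instance Definition _ := Lmodule_isLieAlgebra.Build R (semidirect D)
  semidirect_lie_bilinear semidirect_liexx semidirect_lie_jacobi.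

Lemma semidirect_lieE (x y : h) (a b : r) :
  lie ((x, a) : semidirect D) ((y, b) : semidirect D) =
    (lie x y, lie a b + D x b - D y a).
Proof. by []. Qed.

Variable phi' : {biscalar h}.

Definition semidirect_form (u v : semidirect D) : R :=
  phi' u.1 v.1 + omega u.2 v.2.

Lemma semidirect_form_bilinear : bilinear_for *%R *%R semidirect_form.
Proof.
split=> w a u v; rewrite /semidirect_form /=.
  by rewrite !linearPl mulrDr addrACA.
by rewrite !linearPr mulrDr addrACA.
Qed.

HB.instance Definition _ := bilinear_isBilinear.Build R
  (semidirect D) (semidirect D) R *%R *%R semidirect_form
  semidirect_form_bilinear.

Lemma semidirect_formE (x y : h) (a b : r) :
  semidirect_form (x, a) (y, b) = phi' x y + omega a b.
Proof. by []. Qed.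

End Semidirect.

Arguments semidirect_form {R h r omega} D phi'.

(* Main.v *)
Require Import Defs.
From HB Require Import structures.
From mathcomp Require Import all_boot all_order all_algebra.
From mathcomp Require Import reals.

Import GRing.Theory.
Local Open Scope ring_scope.

(** The form on [h |x_D r] is the orthogonal sum of [phi'] and [omega].

    Its left kernel is therefore the sum of the left kernels of [phi'] and
    [omega], both zero, and in finite dimension a zero left kernel is
    non-degeneracy ([nondegenerate_formP]).

    As [omega] is skew, it adds itself to the skew part of [phi'] and nothing
    to the symmetric part.  The [h]-components contribute the identity for
    [phi'] itself, so it remains to see that the cyclic sum of the bracket of
    [h |x_D r], followed by projection to [r] and pairing by [omega], is zero
    ([semidirect_cocycle]).  Its terms without [D] cancel because [omega] is
    closed on [r]; its terms in [D x], for [x] the [h]-component of one of the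
    three arguments, combine to
    [omega (D x b) c + omega b (D x c)], zero because [D x] is a symplectic
    derivation. *)

Lemma symp_der_skew {R : fieldType} {L : finDimLieAlgType R}
    {omega : {biscalar L}} (A : symp_der omega) (a b : L) :
  omega (A a) b + omega a (A b) = 0.
Proof. by case/symp_derivationP: (symp_der_valP A). Qed.

(** The dual space has the dimension of [V], so an injective map into it is
    onto. *)
Lemma nondegenerate_formP {R : fieldType} {V : vectType R}
    (phi : {biscalar V}) :
  nondegenerate_form phi <-> (forall x, (forall y, phi x y = 0) -> x = 0).
Proof.
split=> [/bij_inj inj_flat x phix0 | ker0].
  by apply: inj_flat; apply/lfunP => y; rewrite !flatE phix0 linear0l.
pose F : 'Hom(V, 'Hom(V, R^o)) := linfun (flat phi).
have FE x : F x = flat phi x by rewrite lfunE.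
have kerF : lker F == 0%VS.
  rewrite -subv0; apply/subvP => x; rewrite memv_ker memv0 => /eqP Fx0.
  by apply/eqP/ker0 => y; rewrite -flatE -FE Fx0 zero_lfunE.
have imF : limg F = fullv.
  apply/eqP; rewrite eqEdim subvf /= limg_dim_eq; last first.
    by rewrite (eqP kerF) capv0.
  by rewrite !dimvf /dim /= muln1.
exists (F^-1)%VF => [x | f]; rewrite -FE; first exact: lker0_lfunK.
by apply: limg_lfunVK; rewrite imF memvf.
Qed.

Lemma sym_part_skew {R : fieldType} {V : vectType R} {omega : {biscalar V}} :
  (forall x y, omega x y = - omega y x) ->
  forall x y, sym_part omega x y = 0.
Proof. by move=> skew x y; rewrite /sym_part skew addNr mul0r. Qed.

Lemma skew_part_skew {R : fieldType} {V : vectType R} {omega : {biscalar V}} :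
  (2 : R) != 0 -> (forall x y, omega x y = - omega y x) ->
  forall x y, skew_part omega x y = omega x y.
Proof.
move=> nz2 skew x y.
by rewrite /skew_part -skew -mulr2n -(mulr_natr (omega x y)) mulfK.
Qed.

Section SemidirectForm.

Context {R : fieldType} {h r : finDimLieAlgType R} {omega : {biscalar r}}.
Variables (D : {lie h -> symp_der omega}) (phi' : {biscalar h}).
Implicit Types u v w : semidirect D.

Lemma sym_part_semidirect u v :
  sym_part (semidirect_form D phi') u v =
    sym_part phi' u.1 v.1 + sym_part omega u.2 v.2.
Proof. by rewrite /sym_part /= /semidirect_form addrACA mulrDl. Qed.

Lemma skew_part_semidirect u v :
  skew_part (semidirect_form D phi') u v =
    skew_part phi' u.1 v.1 + skew_part omega u.2 v.2.
Proof. by rewrite /skew_part /= /semidirect_form opprD addrACA mulrDl. Qed.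

Lemma nondegenerate_semidirect :
  nondegenerate_form phi' -> nondegenerate_form omega ->
  nondegenerate_form (semidirect_form D phi').
Proof.
move=> /nondegenerate_formP ker_phi /nondegenerate_formP ker_omega.
apply/nondegenerate_formP => -[x a] ker_xa; congr pair.
  by apply: ker_phi => y; rewrite -(ker_xa (y, 0)) /=
      semidirect_formE linear0r addr0.
by apply: ker_omega => b; rewrite -(ker_xa (0, b)) /=
    semidirect_formE linear0r add0r.
Qed.

(** That [omega], pulled back along the projection to [r], is a 2-cocycle of
    [h |x_D r], although this projection is not a Lie morphism: the failure is
    measured by the terms in [D], which the symplectic condition cancels. *)
Lemma semidirect_cocycle : symplectic_structure omega ->
  forall u v w,
    omega (lie u v).2 w.2 + omega (lie v w).2 u.2 + omega (lie w u).2 v.2 = 0.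
Proof.
move=> [_ skew closed] [x a] [y b] [z c].
rewrite !semidirect_lieE /= !linearBl !linearDl /=.
(* omega being skew, the form omega (D t _) _ is symmetric, as for any element
   of a symplectic Lie algebra; so the six terms containing D cancel in pairs. *)
have swap (t : h) (p q : r) : omega (D t p) q = omega (D t q) p.
  by apply/eqP; rewrite (skew (D t q)) -addr_eq0 symp_der_skew.
rewrite (swap x b c) (swap y c a) (swap z a b).
rewrite (AC (3*3*3) ((1*4*7)*(2*9)*(3*5)*(6*8))) /=.
by rewrite closed subrr addNr addNr !addr0.
Qed.

End SemidirectForm.

Theorem proposition4p1 (R : realType) (n : nat) (h r : finDimLieAlgType R)
    (phi' : {biscalar h}) (omega : {biscalar r})
    (D : {lie h -> symp_der omega}) :
  \dim {: r} = n.*2 ->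
  symplectic_structure omega ->
  ndb_structure phi' ->
  ndb_structure (semidirect_form D phi').
Proof.
move=> _ symp [nd_phi ndb_phi]; have [nd_omega skew _] := symp.
split=> [|u v w]; first exact: nondegenerate_semidirect.
have nz2 : (2 : R) != 0 by rewrite Num.Theory.pnatr_eq0.
rewrite !skew_part_semidirect sym_part_semidirect (sym_part_skew skew) addr0.
rewrite !(skew_part_skew nz2 skew) -ndb_phi.
rewrite (AC (2*2*2) ((1*3*5)*(2*4*6))) /=.
by rewrite semidirect_cocycle // addr0.
Qed.
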